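(* Let $p_{d,k,n}$ denote the number of directed plateau polyhypercubes of dimension $d$, width $k$ and lateral area $n$. Then for $d\geq 3$, $k\geq 1$ and $n\geq (d-1)k$, $$p_{d,k,n}=\binom{n+(d-1)k-d}{n-(d-1)k}.$$
   Context: Work in $\mathbb{Z}^d$ with orthonormal coordinate system $(0,\vec{i_1},\dots,\vec{i_d})$; a cell is a unit hypercube of the lattice. A polyhypercube of dimension $d$ is a finite union of cells, connected through their $(d-1)$-dimensional faces, defined up to translation. Its width is the number of distinct values of the $\vec{i_1}$-coordinate taken by its cells; its strata are its intersections with the layers of constant $\vec{i_1}$-coordinate. A plateau is a stratum that is a hyperrectangle. An elementary step is a positive move of one unit along one axis. A polyhypercube is directed if every cell can be reached from a distinguished root cell by a path of cells of the polyhypercube using only elementary steps. A directed plateau polyhypercube is a directed polyhypercube all of whose strata are plateaus. The lateral area of a polyhypercube is the sum, over $2\leq l\leq d$, of the areas (numbers of unit squares) of the polyominoes obtained by projecting it onto the planes $(\vec{i_1},\vec{i_l})$. *)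

(* Defs.v *)
From HB Require Import structures.
From mathcomp Require Import all_boot all_order all_algebra.
From mathcomp Require Import finmap.
Set Implicit Arguments. Unset Strict Implicit. Unset Printing Implicit Defensive.
Import Order.TTheory GRing.Theory Num.Theory.
Local Open Scope ring_scope.
Local Open Scope fset_scope.

(* A cell of Z^d is identified with its lower corner, a row vector of
   integers.  Coordinate number 0 is the i_1 coordinate; coordinate j
   (for 0 < j < d) is the i_(j+1) coordinate. *)
Definition cell (d : nat) := 'rV[int]_d.

(* coordinate i of a cell (0 if i >= d, never used in that case) *)
Definition coord (d : nat) (x : cell d) (i : nat) : int :=
  if (insub i : option 'I_d) is Some j then x ord0 j else 0.

Definition fc (d : nat) (x : cell d) : int := coord x 0.

Definition unitv (d : nat) (j : 'I_d) : cell d := delta_mx ord0 j.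

Definition estep (d : nat) : rel (cell d) :=
  fun x y => [exists j : 'I_d, y == (x + unitv j)%R].

(* face adjacency: the two cells share a (d-1)-dimensional face *)
Definition fadj (d : nat) : rel (cell d) :=
  fun x y => estep x y || estep y x.

Definition reach (d : nat) (e : rel (cell d)) (A : {fset cell d}) (a b : cell d) :=
  exists p : seq (cell d),
    [/\ a \in A, all (fun z => z \in A) p, path e a p & last a p = b].

(* polyhypercube (a representative): finite nonempty set of cells,
   connected through (d-1)-faces *)
Definition polyhypercube (d : nat) (A : {fset cell d}) :=
  A != fset0 /\ forall a b, a \in A -> b \in A -> reach (@fadj d) A a b.

Definition directed (d : nat) (A : {fset cell d}) :=
  polyhypercube A /\
  exists2 r, r \in A & forall c, c \in A -> reach (@estep d) A r c.

Definition stratum (d : nat) (A : {fset cell d}) (t : int) : {fset cell d} :=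
  [fset x in A | fc x == t].

Definition plateau (d : nat) (S : {fset cell d}) (t : int) :=
  exists lo hi : cell d, forall x : cell d, fc x = t ->
    (x \in S <-> forall j : 'I_d, (0 < (j : nat))%N -> lo ord0 j <= x ord0 j <= hi ord0 j).

Definition dir_plateau (d : nat) (A : {fset cell d}) :=
  directed A /\ forall t, t \in [fset fc x | x in A] -> plateau (stratum A t) t.

Definition width (d : nat) (A : {fset cell d}) : nat := #|` [fset fc x | x in A]|.

Definition lateral_area (d : nat) (A : {fset cell d}) : nat :=
  (\sum_(j : 'I_d | (0 < (j : nat))%N) #|` [fset (fc x, x ord0 j) | x in A]|)%N.

Definition translate (d : nat) (A : {fset cell d}) (v : cell d) : {fset cell d} :=
  [fset (x + v)%R | x in A].

Definition translates (d : nat) (A B : {fset cell d}) := exists v, A = translate B v.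

(* p_{d,k,n} = c : the translation classes of directed plateau
   polyhypercubes of dimension d, width k and lateral area n are exactly
   represented, without repetition, by a list of length c *)
Definition count_dpp (d k n c : nat) :=
  exists s : seq {fset cell d},
    [/\ size s = c,
        (forall A, A \in s -> [/\ dir_plateau A, width A = k & lateral_area A = n]),
        (forall A, dir_plateau A -> width A = k -> lateral_area A = n ->
           exists2 B, B \in s & translates A B)
      & (forall i j, (i < size s)%N -> (j < size s)%N ->
           translates (nth fset0 s i) (nth fset0 s j) -> i = j)].

(* Main.v *)
(* Layer t of a directed plateau polyhypercube is a box [lo t, hi t].  The only
   entry into the lowest cell of layer t+1 comes from below, so directedness
   amounts to lo t <= lo (t+1) <= hi t along every axis other than the first.
   Hence, along each of these d-1 axes, the 2k-1 naturals lo (t+1) - lo t,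
   hi t - lo (t+1) (t < k-1) and hi (k-1) - lo (k-1) are arbitrary, determine
   the object up to translation, and sum to the projected area minus k: what is
   counted is weak compositions of n - (d-1)k into (d-1)(2k-1) parts. *)
Require Import Defs.
From mathcomp Require Import all_boot all_order all_algebra.
From mathcomp Require Import finmap zify.
Set Implicit Arguments. Unset Strict Implicit. Unset Printing Implicit Defensive.
Import Order.TTheory GRing.Theory Num.Theory.
Local Open Scope fset_scope.
Local Open Scope ring_scope.

(** * Paths of cells and directedness *)

Lemma reach_ind d (e : rel (cell d)) (A : {fset cell d}) a b (P : cell d -> Prop) :
  P a -> (forall y z, y \in A -> z \in A -> e y z -> P y -> P z) ->
  reach e A a b -> P b.
Proof.
move=> + step [p [+ + + <-]]; elim: p a => [|y p IHp] a //= Pa aA.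
by case/andP=> yA pA /andP[ey ep]; apply: IHp => //; apply: step Pa.
Qed.

Lemma reach_refl d (e : rel (cell d)) (A : {fset cell d}) a : a \in A -> reach e A a a.
Proof. by exists [::]. Qed.

Lemma reach_trans d (e : rel (cell d)) (A : {fset cell d}) a b c :
  reach e A a b -> reach e A b c -> reach e A a c.
Proof.
move=> [p [aA pA ep lp]] [s [bA sA es <-]]; exists (p ++ s).
by rewrite all_cat pA cat_path ep lp es last_cat lp.
Qed.

Lemma reach1 d (e : rel (cell d)) (A : {fset cell d}) a b :
  a \in A -> b \in A -> e a b -> reach e A a b.
Proof. by move=> aA bA eab; exists [:: b]; rewrite /= aA bA eab. Qed.

Lemma reach_sym d (e : rel (cell d)) (A : {fset cell d}) a b :
  symmetric e -> reach e A a b -> reach e A b a.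
Proof.
move=> esym rab; have [p [aA _ _ _]] := rab.
apply: (reach_ind (P := fun z => reach e A z a)) rab; first exact: reach_refl.
move=> y z yA zA eyz; apply: reach_trans; apply: reach1 => //.
by rewrite esym.
Qed.

Lemma reach_sub d (e e' : rel (cell d)) (A : {fset cell d}) a b :
  subrel e e' -> reach e A a b -> reach e' A a b.
Proof. by move=> ee' [p [aA pA ep lp]]; exists p; rewrite (sub_path ee'). Qed.

(** Applied later to the lowest cell of a layer, to inspect the step that enters it. *)
Lemma reach_last d (e : rel (cell d)) (A : {fset cell d}) a b :
  reach e A a b -> a = b \/ exists2 y, y \in A & e y b.
Proof.
apply: (reach_ind (P := fun b => a = b \/ exists2 y, y \in A & e y b)).
  by left.
by move=> y z yA _ eyz _; right; exists y.
Qed.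

(** Connectedness follows: go back to the root by reversed elementary steps, then forward. *)
Lemma directed_of_root d (A : {fset cell d}) r :
  r \in A -> (forall c, c \in A -> reach (@estep d) A r c) -> directed A.
Proof.
move=> rA rootA; split; last by exists r.
split; first by apply/fset0Pn; exists r.
have fsym : symmetric (@fadj d) by move=> x y; rewrite /fadj orbC.
have sub : subrel (@estep d) (@fadj d) by move=> x y; rewrite /fadj => ->.
move=> a b aA bA; apply: (@reach_trans _ _ _ _ r).
  by apply: reach_sym => //; apply: reach_sub (rootA _ aA).
exact: reach_sub (rootA _ bA).
Qed.

(** * Coordinates and finite boxes of cells *)

Lemma fcE d (x : cell d.+1) : fc x = x ord0 ord0.
Proof. by rewrite /fc /Defs.coord insubT; congr (x _ _); apply/val_inj. Qed.

Lemma cellP d (x y : cell d) : (forall j, x ord0 j = y ord0 j) <-> x = y.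
Proof. by split=> [xy|-> //]; apply/matrixP => i j; rewrite ord1. Qed.

Lemma cellD d (x y : cell d) j : (x + y) ord0 j = x ord0 j + y ord0 j :> int.
Proof. by rewrite mxE. Qed.

Lemma cellB d (x y : cell d) j : (x - y) ord0 j = x ord0 j - y ord0 j :> int.
Proof. by rewrite !mxE. Qed.

(* [imfsetP] with [x] typed as a [cell], so that [lia] recognizes its coordinates. *)
Lemma imcellP d (K : choiceType) (g : cell d -> K) (A : {fset cell d}) y :
  reflect (exists2 x : cell d, x \in A & y = g x) (y \in [fset g x | x in A]).
Proof. exact: imfsetP. Qed.

Lemma unitvE d (j i : 'I_d) : unitv j ord0 i = (i == j)%:Z.
Proof. by rewrite mxE eqxx; case: eqP. Qed.

Definition in_box d (lo hi x : cell d) := [forall j, lo ord0 j <= x ord0 j <= hi ord0 j].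

Lemma in_boxP d (lo hi x : cell d) :
  reflect (forall j, lo ord0 j <= x ord0 j <= hi ord0 j) (in_box lo hi x).
Proof. exact: forallP. Qed.

(** Offsets from [lo] range over a finite function type: [M], the sum of all side lengths, bounds
    each offset, and the filter then cuts out the box. *)
Definition box d (lo hi : cell d) : {fset cell d} :=
  let M := (\sum_j `|hi ord0 j - lo ord0 j|)%N in
  [fset x in [seq lo + \row_j (u j : nat)%:Z | u : {ffun 'I_d -> 'I_M.+1}] | in_box lo hi x].

Lemma mem_box d (lo hi x : cell d) : (x \in box lo hi) = in_box lo hi x.
Proof.
rewrite !inE /= andbC; case: in_boxP => //= lxh.
apply/mapP; exists [ffun j => inord `|x ord0 j - lo ord0 j|]; first by rewrite mem_enum.
apply/cellP => j; rewrite cellD mxE ffunE inordK.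
  by have := lxh j; lia.
by rewrite ltnS (bigD1 j) //=; have := lxh j; lia.
Qed.

(** Induction on the l1 distance to [lo]: a cell of the box other than [lo] exceeds it along some
    axis, and the step back along that axis stays in the box. *)
Lemma box_reach d (A : {fset cell d}) lo hi x :
  (forall y, in_box lo hi y -> y \in A) -> in_box lo hi x -> reach (@estep d) A lo x.
Proof.
move=> boxA; have [N] := ubnP (\sum_j `|x ord0 j - lo ord0 j|)%N.
elim: N x => // N IHN x; rewrite ltnS => leN /in_boxP xbox.
have [eqx|] := eqVneq x lo.
  by rewrite eqx in xbox *; apply: reach_refl; apply/boxA/in_boxP.
move=> neqx; have [j neqj] : exists j, x ord0 j != lo ord0 j.
  apply/existsP; rewrite -negb_forall; apply: contra neqx => /eqfunP xlo.
  by apply/eqP/cellP.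
have ybox : in_box lo hi (x - unitv j).
  apply/in_boxP => i; rewrite cellB unitvE; have := xbox i.
  by case: (eqVneq i j) => [-> | _]; lia.
apply: (@reach_trans _ _ _ _ (x - unitv j)).
  apply: IHN => //; apply: leq_trans leN.
  rewrite [X in (X < _)%N](bigD1 j) // [X in (_ < X)%N](bigD1 j) //= -addSn leq_add //.
    by rewrite cellB unitvE eqxx; have := xbox j; lia.
  by apply: leq_sum => i /negbTE ij; rewrite cellB unitvE ij; lia.
apply: reach1; [exact: boxA | by apply/boxA/in_boxP |].
by apply/existsP; exists j; rewrite subrK.
Qed.

(** * Stacks of boxes, one per layer: width, lateral area, directedness, uniqueness *)

Lemma card_fset_seq (K : choiceType) (A : {fset K}) (s : seq K) :
  uniq s -> A =i s -> #|` A| = size s.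
Proof. by move=> us As; apply: perm_size; apply: uniq_perm => //; apply: fset_uniq. Qed.

(* The layers are the first coordinates r, ..., r + q, so the width is q + 1. *)
Definition stacked d (r : int) (q : nat) (lo hi : nat -> cell d.+1) (A : {fset cell d.+1}) :=
  [/\ forall x : cell d.+1, x \in A <-> exists2 t, (t <= q)%N & in_box (lo t) (hi t) x,
      forall t, (t <= q)%N -> lo t ord0 ord0 = r + t%:Z /\ hi t ord0 ord0 = r + t%:Z
    & forall t j, (t <= q)%N -> lo t ord0 j <= hi t ord0 j].

(** The form directedness takes for a stack: an elementary path can reach the lowest corner of layer
    t+1 only from the cell below it. *)
Definition linked d (q : nat) (lo hi : nat -> cell d.+1) :=
  forall t, (t < q)%N -> in_box (lo t) (hi t) (lo t.+1 - unitv ord0).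

Lemma stacked_lo d r q lo hi (A : {fset cell d.+1}) t :
  stacked r q lo hi A -> (t <= q)%N -> lo t \in A.
Proof. by move=> [AP _ le] tq; apply/AP; exists t => //; apply/in_boxP => j; rewrite lexx le. Qed.

Lemma stacked_hi d r q lo hi (A : {fset cell d.+1}) t :
  stacked r q lo hi A -> (t <= q)%N -> hi t \in A.
Proof. by move=> [AP _ le] tq; apply/AP; exists t => //; apply/in_boxP => j; rewrite lexx le. Qed.

Lemma stacked_layer d r q lo hi (A : {fset cell d.+1}) t x :
  stacked r q lo hi A -> (t <= q)%N -> fc x = r + t%:Z ->
  x \in A <-> in_box (lo t) (hi t) x.
Proof.
move=> [AP fcP _] tq fx; split=> [/AP[s sq xs] | xt]; last by apply/AP; exists t.
suff -> : t = s by [].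
by have [] := fcP s sq; have /in_boxP/(_ ord0) := xs; rewrite fcE in fx; lia.
Qed.

Lemma stacked_fc d r q lo hi (A : {fset cell d.+1}) y :
  stacked r q lo hi A ->
  y \in [fset fc x | x in A] <-> exists2 t, (t <= q)%N & y = r + t%:Z.
Proof.
move=> stA; have [AP fcP _] := stA; split=> [/imcellP[x /AP[t tq xt] ->] | [t tq ->]].
  exists t => //; have [] := fcP t tq; have /in_boxP/(_ ord0) := xt.
  by rewrite fcE; lia.
by apply/imcellP; exists (lo t); [exact: stacked_lo stA tq | rewrite fcE; have [->] := fcP t tq].
Qed.

Lemma stacked_width d r q lo hi (A : {fset cell d.+1}) :
  stacked r q lo hi A -> width A = q.+1.
Proof.
move=> stA; rewrite /width (@card_fset_seq _ _ [seq r + t%:Z | t <- iota 0 q.+1]).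
- by rewrite size_map size_iota.
- by rewrite map_inj_uniq ?iota_uniq // => s t; lia.
- move=> y; apply/idP/mapP => [/(stacked_fc _ stA)[t tq ->]|[t + ->]].
    by exists t => //; rewrite mem_iota.
  by rewrite mem_iota => /andP[_ tq]; apply/(stacked_fc _ stA); exists t.
Qed.

(** Each projection is a disjoint union of rows, one per layer; a row is the integer interval from
    [lo] to [hi], both ends included, whence the successor. *)
Lemma stacked_area d r q lo hi (A : {fset cell d.+1}) :
  stacked r q lo hi A ->
  lateral_area A = (\sum_(j : 'I_d) \sum_(t < q.+1)
    `|hi t ord0 (lift ord0 j) - lo t ord0 (lift ord0 j)|.+1)%N.
Proof.
move=> stA; have [AP fcP le] := stA.
rewrite /lateral_area big_mkcond big_ord_recl /= add0n; apply: eq_bigr => i _.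
set j := lift ord0 i; pose h t := `|hi t ord0 j - lo t ord0 j|.+1.
rewrite (@card_fset_seq _ _ [seq (r + t%:Z, lo t ord0 j + s%:Z) | t <- iota 0 q.+1, s <- iota 0 (h t)]).
- rewrite size_allpairs_dep sumnE big_map -[iota 0 _]/(index_iota 0 q.+1) big_mkord.
  by apply: eq_bigr => t _; rewrite size_iota.
- apply: allpairs_uniq_dep; first exact: iota_uniq.
    by move=> t _; apply: iota_uniq.
  move=> [t s] [t' s'] _ _ /= [tt]; have {tt} <- : t = t' by lia.
  by move=> ss; have <- : s = s' by lia.
- move=> y; apply/imcellP/allpairsPdep => [[x xA ->] | [t [s [+ + ->]]]].
    have /AP[t tq xt] := xA; exists t, `|x ord0 j - lo t ord0 j|%N.
    have [] := fcP t tq; have /in_boxP xb := xt; have := xb ord0; have := xb j.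
    by rewrite !mem_iota /h fcE; split; [lia | lia | congr (_, _); lia].
  rewrite !mem_iota /h => tq sh; have {}tq : (t <= q)%N by lia.
  (* A preimage of the given square: the lowest corner of layer [t], moved along axis [j] only. *)
  exists (\row_i if i == j then lo t ord0 j + s%:Z else lo t ord0 i).
    apply/AP; exists t => //; apply/in_boxP => l; rewrite mxE; have := le t l tq.
    by case: eqVneq => [->|_]; lia.
  by rewrite fcE !mxE eqxx /=; have [-> _] := fcP t tq.
Qed.

(** The root is the lowest corner of layer 0. Inside layer t, walk from [lo t] to the cell below
    [lo t.+1], then step along the first axis. *)
Lemma stacked_dir_plateau d r q lo hi (A : {fset cell d.+1}) :
  stacked r q lo hi A -> linked q lo hi -> dir_plateau A.
Proof.
move=> stA lk; have [AP fcP le] := stA; split.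
  apply: (directed_of_root (r := lo 0%N)); first exact: stacked_lo stA _.
  have boxA t y : (t <= q)%N -> in_box (lo t) (hi t) y -> y \in A.
    by move=> tq yt; apply/AP; exists t.
  have lo_reach t : (t <= q)%N -> reach (@estep d.+1) A (lo 0%N) (lo t).
    elim: t => [|t IHt] tq; first by apply: reach_refl; exact: stacked_lo stA _.
    apply: reach_trans (IHt (ltnW tq)) _.
    apply: reach_trans (box_reach _ (lk t tq)) _ => [y|]; first exact/boxA/ltnW.
    apply: reach1; [exact: boxA (ltnW tq) (lk _ _) | exact: stacked_lo stA _ |].
    by apply/existsP; exists ord0; rewrite subrK.
  move=> c /AP[t tq ct]; apply: reach_trans (lo_reach t tq) _.
  by apply: box_reach ct => y; apply: boxA.
move=> y /(stacked_fc _ stA)[t tq ->]; exists (lo t), (hi t) => x fx.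
rewrite !inE fx eqxx andbT; split.
  by move=> /(stacked_layer stA tq fx)/in_boxP xb j _; apply: xb.
move=> xb; apply/(stacked_layer stA tq fx)/in_boxP => j.
have [->|j0] := eqVneq j ord0; last by apply: xb; rewrite lt0n.
by rewrite -[x _ _]fcE fx; have [-> ->] := fcP t tq; rewrite lexx.
Qed.

Lemma stacked_translate d r q lo hi (A : {fset cell d.+1}) (v : cell d.+1) :
  stacked r q lo hi A ->
  stacked (r + v ord0 ord0) q (fun t => lo t + v) (fun t => hi t + v) (translate A v).
Proof.
move=> [AP fcP le]; split=> [x|t tq|t j tq].
- have -> : (x \in translate A v) = (x - v \in A).
    apply/imcellP/idP => [[y yA ->]|xA]; first by rewrite addrK.
    by exists (x - v); rewrite ?subrK.
  rewrite AP; split=> -[t tq /in_boxP xb]; exists t => //; apply/in_boxP => j;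
    by have := xb j; rewrite ?cellB ?cellD; lia.
- by rewrite !cellD; have [-> ->] := fcP t tq; split; lia.
- by rewrite !cellD; have := le t j tq; lia.
Qed.

(** Both [r] and [r'] are the least first coordinate; in each layer, the corners of either
    description lie in the box of the other, which forces equality. *)
Lemma stacked_uniq d r r' q lo lo' hi hi' (A : {fset cell d.+1}) :
  stacked r q lo hi A -> stacked r' q lo' hi' A ->
  r = r' /\ forall t, (t <= q)%N -> lo t = lo' t /\ hi t = hi' t.
Proof.
move=> stA stA'; have [_ fcP _] := stA; have [_ fcP' _] := stA'.
have rr : r = r'.
  have [t _ ?] : exists2 t, (t <= q)%N & r = r' + t%:Z.
    by apply/(stacked_fc _ stA')/(stacked_fc _ stA); exists 0%N; rewrite ?addr0.
  have [s _ ?] : exists2 t, (t <= q)%N & r' = r + t%:Z.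
    by apply/(stacked_fc _ stA)/(stacked_fc _ stA'); exists 0%N; rewrite ?addr0.
  lia.
subst r'; split=> // t tq.
have [f1 f2] := fcP t tq; have [f1' f2'] := fcP' t tq.
have /in_boxP l1 : in_box (lo' t) (hi' t) (lo t).
  by apply/(stacked_layer stA'); rewrite ?fcE //; apply: stacked_lo stA tq.
have /in_boxP l2 : in_box (lo' t) (hi' t) (hi t).
  by apply/(stacked_layer stA'); rewrite ?fcE //; apply: stacked_hi stA tq.
have /in_boxP l3 : in_box (lo t) (hi t) (lo' t).
  by apply/(stacked_layer stA); rewrite ?fcE //; apply: stacked_lo stA' tq.
have /in_boxP l4 : in_box (lo t) (hi t) (hi' t).
  by apply/(stacked_layer stA); rewrite ?fcE //; apply: stacked_hi stA' tq.
by split; apply/cellP => j; have := l1 j; have := l2 j; have := l3 j; have := l4 j; lia.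
Qed.

(** * From directed plateau polyhypercubes to linked stacks *)

Lemma fset_initial_segment (S : {fset int}) (r : int) :
  (forall y : int, y \in S -> r <= y) ->
  (forall y z : int, y \in S -> r <= z <= y -> z \in S) ->
  forall y : int, y \in S <-> exists2 t, (t < #|` S|)%N & y = r + t%:Z.
Proof.
move=> ge segS.
have [M ubM] : exists M, forall y : int, y \in S -> (`|y - r| <= M)%N.
  by exists (\max_(y <- S) `|y - r|) => y yS; apply: (leq_bigmax_seq (P := xpredT)).
have exK : exists K, r + K%:Z \notin S.
  by exists M.+1; apply/negP => /ubM; lia.
(* The segment stops at the least [K] with r + K outside [S]; this [K] is the cardinal of [S]. *)
case: (ex_minnP exK) => K KS minK.
have SK (y : int) : y \in S <-> exists2 t, (t < K)%N & y = r + t%:Z.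
  split=> [yS|[t tK ->]].
    have ry := ge y yS; exists `|y - r|%N; last by lia.
    rewrite ltnNge; apply/negP => Ky; case/negP: KS; apply: segS yS _; lia.
  by apply: contraTT tK => /minK; rewrite -leqNgt.
suff -> : #|` S| = K by [].
rewrite (@card_fset_seq _ _ [seq r + t%:Z | t <- iota 0 K]) ?size_map ?size_iota //.
  by rewrite map_inj_uniq ?iota_uniq // => s t; lia.
move=> y; apply/idP/mapP => [/SK[t tK ->]|[t + ->]].
  by exists t => //; rewrite mem_iota.
by rewrite mem_iota => /andP[_ tK]; apply/SK; exists t.
Qed.

Lemma dir_plateau_stacked d q (A : {fset cell d.+1}) :
  dir_plateau A -> width A = q.+1 ->
  exists r lo hi, stacked r q lo hi A /\ linked q lo hi.
Proof.
move=> [[_ [r rA rr]] pl] wA.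
have estepE (y z : cell d.+1) : estep y z -> exists j, forall i, z ord0 i = y ord0 i + (i == j)%:Z.
  by move=> /existsP[j /eqP ->]; exists j => i; rewrite cellD unitvE.
(* Elementary steps never lower the first coordinate, so the root lies in the lowest layer. *)
have rle (c : cell d.+1) : c \in A -> fc r <= fc c.
  move=> /rr; apply: (reach_ind (P := fun z => fc r <= fc z)) => // y z _ _.
  by move=> /estepE[j /(_ ord0)]; rewrite !fcE; lia.
set S := [fset fc x | x in A] in pl.
have memS (c : cell d.+1) : c \in A -> fc c \in S by move=> cA; apply/imcellP; exists c.
have SP (y : int) : y \in S <-> exists2 t, (t <= q)%N & y = fc r + t%:Z.
  have cardS : #|` S| = q.+1 := wA.
  have := @fset_initial_segment S (fc r); rewrite cardS; apply=> {}y.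
    by move=> /imcellP[c cA ->]; apply: rle.
  (* A step raises the first coordinate by at most one, so a path from the root skips no layer. *)
  move=> z /imcellP[c /rr rc ->]; move: z.
  apply: (reach_ind (P := fun c : cell d.+1 => forall z : int, fc r <= z <= fc c -> z \in S)) rc.
    by move=> z rz; rewrite (_ : z = fc r); [exact: memS rA | lia].
  move=> x {}y xA yA /estepE[j /(_ ord0)]; rewrite -!fcE => xy IH z rz.
  have [->|zy] := eqVneq z (fc y); first exact: memS.
  by apply: IH; lia.
have bounds (i : 'I_q.+1) : exists p : cell d.+1 * cell d.+1, forall x : cell d.+1,
    fc x = fc r + (i : nat)%:Z ->
    (x \in A <-> forall j : 'I_d.+1, (0 < j)%N -> p.1 ord0 j <= x ord0 j <= p.2 ord0 j).
  have [|lo [hi P]] := pl (fc r + (i : nat)%:Z).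
    by apply/SP; exists i => //; rewrite -ltnS.
  by exists (lo, hi) => x fx; rewrite -P // !inE fx eqxx andbT.
have [u uP] := fin_all_exists bounds.
(* Plateau bounds leave the first coordinate free; here it gets the value of the layer. [inord t]
   falls back on index 0 when t > q. *)
pose corner (p : 'I_q.+1 -> cell d.+1) t : cell d.+1 :=
  \row_j if j == ord0 then fc r + t%:Z else p (inord t) ord0 j.
pose lo := corner (fun i => (u i).1); pose hi := corner (fun i => (u i).2).
have lo0 t : lo t ord0 ord0 = fc r + t%:Z by rewrite mxE eqxx.
have hi0 t : hi t ord0 ord0 = fc r + t%:Z by rewrite mxE eqxx.
have layer t (x : cell d.+1) : (t <= q)%N -> fc x = fc r + t%:Z -> x \in A <-> in_box (lo t) (hi t) x.
  move=> tq fx; rewrite (uP (inord t)) ?inordK //; split=> [xb|/in_boxP xb j j0].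
    apply/in_boxP => j; have [->|j0] := eqVneq j ord0.
      by rewrite lo0 hi0 -fcE fx lexx.
    by rewrite !mxE (negbTE j0); apply: xb; rewrite lt0n.
  by have := xb j; rewrite !mxE -[j == ord0]negbK -[j != ord0]lt0n j0.
have AP (x : cell d.+1) : x \in A <-> exists2 t, (t <= q)%N & in_box (lo t) (hi t) x.
  split=> [xA | [t tq xt]].
    by have /SP[t tq fx] := memS x xA; exists t => //; apply/layer.
  apply/(layer t) => //; have /in_boxP/(_ ord0) := xt; rewrite lo0 hi0 (fcE x); lia.
(* Layer t is nonempty, and any of its cells lies between [lo t] and [hi t]. *)
have st : stacked (fc r) q lo hi A.
  split=> // t j tq; have [c cA fx] : exists2 c : cell d.+1, c \in A & fc r + t%:Z = fc c.
    by apply/imcellP/SP; exists t.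
  by have /(layer t c tq (esym fx))/in_boxP/(_ j) := cA; lia.
exists (fc r), lo, hi; split=> // t tq.
have loA := stacked_lo st tq.
(* How [lo t.+1] is reached: it is not the root, which lies in a lower layer; a last step along the
   first axis gives the link; one along another axis would start in the same layer but outside its
   box. *)
have [rlo|[y yA /existsP[j /eqP loy]]] := reach_last (rr _ loA).
  by have := lo0 t.+1; rewrite -rlo -(fcE r); lia.
have [j0|j0] := eqVneq j ord0.
  have yE : y = lo t.+1 - unitv ord0 by rewrite loy j0 addrK.
  rewrite -yE; apply/layer => //; first exact: ltnW.
  by rewrite yE fcE cellB lo0 unitvE eqxx; lia.
have fy : fc y = fc r + t.+1%:Z.
  by rewrite -lo0 loy fcE cellD unitvE [ord0 == j]eq_sym (negbTE j0) addr0.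
have /(layer t.+1 y tq fy)/in_boxP/(_ j) : y \in A by [].
by rewrite loy cellD unitvE eqxx; lia.
Qed.

(** * Gap coordinates of linked stacks *)

Definition stack d q (lo hi : nat -> cell d) : {fset cell d} :=
  \bigcup_(t <- iota 0 q.+1) box (lo t) (hi t).

Lemma stack_stacked d r q (lo hi : nat -> cell d.+1) :
  (forall t, lo t ord0 ord0 = r + t%:Z /\ hi t ord0 ord0 = r + t%:Z) ->
  (forall t j, (t <= q)%N -> lo t ord0 j <= hi t ord0 j) ->
  stacked r q lo hi (stack q lo hi).
Proof.
move=> fcP le; split=> // x; split=> [/bigfcupP[t] | [t tq xt]].
  by rewrite mem_iota andbT mem_box; exists t.
by apply/bigfcupP; exists t; rewrite ?mem_box // mem_iota andbT.
Qed.

(* Here q = k-1; odd [s] gives lo (t+1) - lo t, even [s] gives hi t - lo (t+1),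
   or hi q - lo q when t = q. *)
Definition gap d q (lo hi : nat -> cell d.+1) (i : 'I_d) (s : nat) : nat :=
  let t := s./2 in
  if odd s then `|lo t.+1 ord0 (lift ord0 i) - lo t ord0 (lift ord0 i)|%N
  else `|hi t ord0 (lift ord0 i) - lo (minn t.+1 q) ord0 (lift ord0 i)|%N.

(** Together with [gap_hi], the inverse of [gap], normalised by placing the lowest corner of layer 0
    at the origin. *)
Definition gap_lo d (f : 'I_d -> nat -> nat) (t : nat) : cell d.+1 :=
  \row_j (if unlift ord0 j is Some i then (\sum_(s < t) f i s.*2.+1)%N else t)%:Z.

(** The even gap is added to the lowest corner of the next layer; for t = q, [minn] selects the
    layer's own corner instead. *)
Definition gap_hi d q (f : 'I_d -> nat -> nat) (t : nat) : cell d.+1 :=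
  \row_j (if unlift ord0 j is Some i
          then (\sum_(s < minn t.+1 q) f i s.*2.+1 + f i t.*2)%N else t)%:Z.

Lemma gap_lo0 d (f : 'I_d -> nat -> nat) t : gap_lo f t ord0 ord0 = t%:Z.
Proof. by rewrite mxE unlift_none. Qed.

Lemma gap_hi0 d q (f : 'I_d -> nat -> nat) t : gap_hi q f t ord0 ord0 = t%:Z.
Proof. by rewrite mxE unlift_none. Qed.

Lemma gap_loE d (f : 'I_d -> nat -> nat) t i :
  gap_lo f t ord0 (lift ord0 i) = (\sum_(s < t) f i s.*2.+1)%N%:Z.
Proof. by rewrite mxE liftK. Qed.

Lemma gap_hiE d q (f : 'I_d -> nat -> nat) t i :
  gap_hi q f t ord0 (lift ord0 i) = gap_lo f (minn t.+1 q) ord0 (lift ord0 i) + (f i t.*2)%:Z.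
Proof. by rewrite !mxE liftK. Qed.

Lemma gap_loS d (f : 'I_d -> nat -> nat) t i :
  gap_lo f t.+1 ord0 (lift ord0 i) = gap_lo f t ord0 (lift ord0 i) + (f i t.*2.+1)%:Z.
Proof. by rewrite !gap_loE big_ord_recr. Qed.

Lemma minn_nextP t q : (t <= q)%N ->
  (t < q /\ minn t.+1 q = t.+1)%N \/ (t = q /\ minn t.+1 q = t).
Proof. lia. Qed.

Lemma gap_lo_hi d q (f : 'I_d -> nat -> nat) t i : (t <= q)%N ->
  gap_lo f t ord0 (lift ord0 i) <= gap_hi q f t ord0 (lift ord0 i).
Proof.
by move=> /minn_nextP[[_ tq]|[_ tq]]; rewrite gap_hiE tq ?gap_loS; lia.
Qed.

Lemma gap_stacked d q (f : 'I_d -> nat -> nat) :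
  stacked 0 q (gap_lo f) (gap_hi q f) (stack q (gap_lo f) (gap_hi q f)).
Proof.
apply: stack_stacked => [t | t j tq]; first by rewrite gap_lo0 gap_hi0 add0r.
case: (unliftP ord0 j) => [i|] ->; first exact: gap_lo_hi.
by rewrite gap_lo0 gap_hi0.
Qed.

(** Along the first axis the link condition is automatic; along the others, subtracting [unitv ord0]
    changes nothing. *)
Lemma linkedP d q r (lo hi : nat -> cell d.+1) (A : {fset cell d.+1}) :
  stacked r q lo hi A ->
  linked q lo hi <->
  forall t (i : 'I_d), (t < q)%N ->
    lo t ord0 (lift ord0 i) <= lo t.+1 ord0 (lift ord0 i) <= hi t ord0 (lift ord0 i).
Proof.
move=> [_ fcP _]; split=> [lk t i tq | lk t tq].
  have /in_boxP/(_ (lift ord0 i)) := lk t tq.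
  by rewrite cellB unitvE eq_sym (negbTE (neq_lift _ _)) subr0.
apply/in_boxP => j; rewrite cellB unitvE.
case: (unliftP ord0 j) => [i|] ->.
  by rewrite eq_sym (negbTE (neq_lift _ _)) subr0; apply: lk.
have [-> ->] := fcP t (ltnW tq); have [-> _] := fcP t.+1 tq; rewrite eqxx; lia.
Qed.

(** The link inequalities only say that gaps are nonnegative, so any naturals will do. *)
Lemma gap_linked d q (f : 'I_d -> nat -> nat) : linked q (gap_lo f) (gap_hi q f).
Proof.
apply/(linkedP (gap_stacked q f)) => t i tq; rewrite gap_hiE (minn_idPl tq) gap_loS; lia.
Qed.

Lemma gapK d q (f : 'I_d -> nat -> nat) i s :
  gap q (gap_lo f) (gap_hi q f) i s = f i s.
Proof.
rewrite /gap; case: ifP => odd_s; rewrite ?gap_loS ?gap_hiE addrC addKr absz_nat;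
  congr (f i _); lia.
Qed.

(** Gaps are differences, so a translation cancels; this yields injectivity on translation
    classes. *)
Lemma gap_congr d q (lo hi lo' hi' : nat -> cell d.+1) v i s :
  (forall t, (t <= q)%N -> lo t = lo' t + v /\ hi t = hi' t + v) ->
  (s < q.*2.+1)%N -> gap q lo hi i s = gap q lo' hi' i s.
Proof.
move=> eqv sq; have odd_lt : odd s -> (s./2.+1 <= q)%N by lia.
have [loE hiE] := eqv s./2 ltac:(lia).
rewrite /gap; case: ifP => odd_s.
  have [lo1 _] := eqv s./2.+1 (odd_lt odd_s).
  by rewrite loE lo1 !cellD; lia.
have [lo1 _] := eqv (minn s./2.+1 q) (geq_minr _ _).
by rewrite hiE lo1 !cellD; lia.
Qed.

Lemma sum_odd_even (f : nat -> nat) q :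
  (\sum_(s < q.*2.+1) f s = \sum_(t < q) (f t.*2 + f t.*2.+1) + f q.*2)%N.
Proof.
elim: q => [|q IHq]; first by rewrite big_ord1 big_ord0.
by rewrite doubleS big_ord_recr big_ord_recr /= IHq [in RHS]big_ord_recr /= -!addnA.
Qed.

(** For t < q, the link splits hi t - lo t at lo (t+1) into two nonnegative gaps; the last layer is
    a single gap. *)
Lemma sum_gap d r q (lo hi : nat -> cell d.+1) (A : {fset cell d.+1}) i :
  stacked r q lo hi A -> linked q lo hi ->
  (\sum_(t < q.+1) `|hi t ord0 (lift ord0 i) - lo t ord0 (lift ord0 i)|
   = \sum_(s < q.*2.+1) gap q lo hi i s)%N.
Proof.
move=> st /(linkedP st) lk; rewrite sum_odd_even big_ord_recr /=; congr (_ + _)%N.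
  apply: eq_bigr => t _; rewrite /gap /= odd_double uphalf_double doubleK (minn_idPl (ltn_ord t)).
  by have := lk t i (ltn_ord t) => /=; lia.
by rewrite /gap odd_double doubleK (minn_idPr (leqnSn q)).
Qed.

(** Each of the q+1 rows has one square more than its length hi - lo, along each of the d axes. *)
Lemma area_gap d r q (lo hi : nat -> cell d.+1) (A : {fset cell d.+1}) :
  stacked r q lo hi A -> linked q lo hi ->
  lateral_area A = (\sum_(i < d) \sum_(s < q.*2.+1) gap q lo hi i s + d * q.+1)%N.
Proof.
move=> st lk; rewrite (stacked_area st).
have -> : (d * q.+1 = \sum_(i < d) q.+1)%N by rewrite sum_nat_const card_ord.
rewrite -big_split; apply: eq_bigr => i _ /=; rewrite -(sum_gap i st lk).
under eq_bigr do rewrite -addn1.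
by rewrite big_split sum_nat_const card_ord muln1.
Qed.

(** Odd gaps telescope to [lo], and even gaps then give [hi]; the link makes the differences
    nonnegative, so the absolute values in [gap] lose no sign. *)
Lemma gap_determines d r q (lo hi : nat -> cell d.+1) (A : {fset cell d.+1}) f :
  stacked r q lo hi A -> linked q lo hi ->
  (forall i s, (s < q.*2.+1)%N -> f i s = gap q lo hi i s) ->
  forall t, (t <= q)%N -> lo t = gap_lo f t + lo 0%N /\ hi t = gap_hi q f t + lo 0%N.
Proof.
move=> st /(linkedP st) lk fE; have [_ fcP le] := st.
have loE t i : (t <= q)%N ->
    lo t ord0 (lift ord0 i) = gap_lo f t ord0 (lift ord0 i) + lo 0%N ord0 (lift ord0 i).
  elim: t => [|t IHt] tq; first by rewrite gap_loE big_ord0 add0r.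
  rewrite gap_loS fE ?ltnS ?ltn_double // /gap /= odd_double uphalf_double.
  by have := IHt (ltnW tq); have := lk t i tq => /=; lia.
have fc0 := (fcP 0%N (leq0n _)).1.
move=> t tq; split; apply/cellP => j; rewrite cellD;
  have [i ->|->] := unliftP ord0 j.
- exact: loE.
- by rewrite gap_lo0 fc0; have := fcP t tq; lia.
- have m := loE _ i (geq_minr t.+1 q).
  rewrite gap_hiE fE ?ltnS ?leq_double // /gap odd_double doubleK.
  suff : lo (minn t.+1 q) ord0 (lift ord0 i) <= hi t ord0 (lift ord0 i) by lia.
  have [[lt_tq ->]|[_ ->]] := minn_nextP tq; last exact: le.
  by have := lk t i lt_tq; lia.
- by rewrite gap_hi0 fc0; have := fcP t tq; lia.
Qed.

(** * Counting weak compositions, and the bijection with translation classes *)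

Lemma card_ffun_sum (T : finType) m : (0 < #|T|)%N ->
  #|[set g : {ffun T -> 'I_m.+1} | (\sum_x g x == m)%N]| = 'C(#|T|.-1 + m, m).
Proof.
move=> T0.
(* Stars and bars for tuples; values in ['I_m.+1] suffice, since no part exceeds the sum [m]. *)
have tuples N : (0 < N)%N ->
    #|[set t : N.-tuple 'I_m.+1 | (\sum_(x <- t) x == m)%N]| = 'C(N.-1 + m, m).
  by case: N => // N _; rewrite card_ord_partitions -bin_sub ?leq_addr // addKn.
(* The count passes to functions through the bijection with their graphs, which preserves sums. *)
rewrite -tuples // -(card_imset _ (can_inj (@fgraphK T _))); congr #|pred_of_set _|.
have sumE (g : {ffun T -> 'I_m.+1}) : (\sum_(x <- fgraph g) x = \sum_x g x)%N.
  by rewrite fgraph_codom /= /codom /image_mem big_map big_enum.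
apply/setP => t; apply/imsetP/idP => [[g + ->]|]; rewrite !inE; first by rewrite sumE.
by move=> ts; exists (Finfun t); rewrite ?FinfunK // inE -sumE FinfunK.
Qed.

(** Reads a finite family as a function of a natural [s], the form [gap_lo] and [gap_hi] expect. *)
Definition gaps d q m (g : {ffun 'I_d * 'I_q.*2.+1 -> 'I_m.+1}) (i : 'I_d) (s : nat) : nat :=
  g (i, inord s).

Definition gap_stack d q m (g : {ffun 'I_d * 'I_q.*2.+1 -> 'I_m.+1}) : {fset cell d.+1} :=
  stack q (gap_lo (gaps g)) (gap_hi q (gaps g)).

Lemma sum_gaps d q m (g : {ffun 'I_d * 'I_q.*2.+1 -> 'I_m.+1}) :
  (\sum_p g p = \sum_(i < d) \sum_(s < q.*2.+1) gaps g i s)%N.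
Proof.
by rewrite pair_big; apply: eq_bigr => -[i s] _; rewrite /gaps /= inord_val.
Qed.

Lemma gap_stack_area d q m (g : {ffun 'I_d * 'I_q.*2.+1 -> 'I_m.+1}) :
  lateral_area (gap_stack g) = (\sum_p g p + d * q.+1)%N.
Proof.
rewrite (area_gap (gap_stacked _ _) (@gap_linked _ _ _)) sum_gaps; congr (_ + _)%N.
by apply: eq_bigr => i _; apply: eq_bigr => s _; rewrite gapK.
Qed.

(** Uniqueness of corners makes those of the two stacks differ by one translation, which leaves the
    gaps unchanged. *)
Lemma gap_stack_inj d q m (g g' : {ffun 'I_d * 'I_q.*2.+1 -> 'I_m.+1}) :
  translates (gap_stack g) (gap_stack g') -> g = g'.
Proof.
move=> [v gg']; have := stacked_translate v (gap_stacked q (gaps g')).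
rewrite -/(gap_stack g') -gg' => st; have [_ eqv] := stacked_uniq (gap_stacked q (gaps g)) st.
apply/ffunP => -[i s]; apply/val_inj; have := gap_congr i eqv (ltn_ord s).
by rewrite !gapK /gaps inord_val.
Qed.

Lemma gap_stack_surj d q m (A : {fset cell d.+1}) :
  dir_plateau A -> width A = q.+1 -> lateral_area A = (m + d * q.+1)%N ->
  exists2 g : {ffun 'I_d * 'I_q.*2.+1 -> 'I_m.+1},
    (\sum_p g p = m)%N & translates A (gap_stack g).
Proof.
move=> dA wA; have [r [lo [hi [st lk]]]] := dir_plateau_stacked dA wA.
rewrite (area_gap st lk) => /addIn sum_m.
pose g := [ffun p : 'I_d * 'I_q.*2.+1 => inord (gap q lo hi p.1 p.2) : 'I_m.+1].
have gE i s : (s < q.*2.+1)%N -> gaps g i s = gap q lo hi i s.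
  (* A gap is one term of a sum equal to [m], hence at most [m], and [inord] keeps its value. *)
  move=> sq; rewrite /gaps ffunE /= !inordK // ltnS -sum_m (bigD1 i) //=.
  by rewrite (bigD1 (Ordinal sq)) //= -!addnA leq_addr.
exists g.
  rewrite sum_gaps -[RHS]sum_m; apply: eq_bigr => i _; apply: eq_bigr => s _; exact: gE.
have eqv := gap_determines st lk gE; exists (lo 0%N); apply/fsetP => x.
have [AP _ _] := st; have [BP _ _] := stacked_translate (lo 0%N) (gap_stacked q (gaps g)).
apply/idP/idP => [/AP[t tq xt] | /BP[t tq xt]]; [apply/BP | apply/AP];
  by exists t => //; have [e1 e2] := eqv t tq; move: xt; rewrite e1 e2.
Qed.

Theorem theorem3 (d k n : nat) :
  (3 <= d)%N -> (1 <= k)%N -> ((d - 1) * k <= n)%N ->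
  count_dpp d k n 'C(n + (d - 1) * k - d, n - (d - 1) * k).
Proof.
(* From here on, [d] counts the axes other than the first, and the width is q+1. *)
case: d => // d d3; case: k => // q _; rewrite subn1 /= => le_n.
set m := (n - d * q.+1)%N; have nE : n = (m + d * q.+1)%N by rewrite subnK.
pose G := [set g : {ffun 'I_d * 'I_q.*2.+1 -> 'I_m.+1} | (\sum_p g p == m)%N].
have card_pos : (0 < #|{: 'I_d * 'I_q.*2.+1}|)%N.
  by rewrite card_prod !card_ord muln_gt0 andbT; lia.
exists [seq gap_stack g | g <- enum G]; split.
- rewrite size_map -cardE card_ffun_sum // card_prod !card_ord; congr 'C(_, _).
  (* There are d(2q+1) parts, and d(2q+1) - 1 + m = n + d(q+1) - (d+1). *)
  by rewrite nE -muln2; nia.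
- move=> A /mapP[g]; rewrite mem_enum inE => /eqP sum_g ->; split.
  + exact: stacked_dir_plateau (gap_stacked _ _) (@gap_linked _ _ _).
  + exact: stacked_width (gap_stacked _ _).
  + by rewrite gap_stack_area sum_g.
- move=> A dA wA; rewrite nE => aA; have [g sum_g tr] := gap_stack_surj dA wA aA.
  by exists (gap_stack g) => //; apply: map_f; rewrite mem_enum inE sum_g.
- move=> i j; rewrite !size_map => iG jG.
  (* [g0] supplies the default value that [nth] needs on [enum G]. *)
  have [g0 _] : exists g0, g0 \in enum G by exists (nth [ffun=> ord0] (enum G) i); rewrite mem_nth.
  rewrite !(nth_map g0) // => /gap_stack_inj/eqP.
  by rewrite nth_uniq ?enum_uniq // => /eqP.
Qed.
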